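(* Let $(\theta(t),\omega(t))$, $t\ge 0$, be a solution to the inertial Kuramoto system with frustration $$m\ddot\theta_i(t)+\dot\theta_i(t)=\Omega_i+\frac{K}{N}\sum_{j=1}^N\psi_{ij}\sin(\theta_j(t)-\theta_i(t)+\alpha),\qquad i=1,\dots,N,$$ with $\omega_i=\dot\theta_i$, on a symmetric and connected network. Suppose $\beta,\gamma,D^\infty,\delta,c$ are positive constants such that, with $\eta=1-\frac{2}{c}$ and $S_c=\sum_{n=0}^{N-1}c^n$, the following hold. (1) $\beta\in(0,\pi)$ and $2mD(\Omega)+4mK\psi_u\sin\alpha+(1+4mK\psi_u\cos\alpha)D_\theta(0)+3mD_\omega(0)<\beta$. (2) $\beta<\gamma<\pi$, $\ 0<D^\infty<\min\{\frac{\pi}{2},\beta\}$, $\ \alpha<\delta<\frac{\pi}{2}-D^\infty$, $\ c>\max\left\{\frac{2}{\cos(D^\infty+\delta)},\frac{2}{1-\frac{\beta}{\gamma}}\right\}$. (3) $$mK<\min\left\{\frac{\eta^2\psi_l\sin\gamma}{16N\psi_u^2S_c\gamma},\ \frac{NS_c}{2\psi_l}\right\},\qquad K>\frac{4(D(\Omega)+2K\psi_u\sin\alpha)NS_c\gamma}{D^\infty\eta\psi_l\cos\alpha\sin\gamma},$$ $$K>\frac{64(D(\Omega)+2K\psi_u\sin\alpha)(D^\infty\cos\alpha+\sin\alpha)N^3\psi_u^2S_c^3\gamma^2}{\eta^3\psi_l^3\cos\alpha\sin^2\gamma}.$$ Let $$\mathcal{E}_1(t)=Q(t)+\frac{\eta\psi_l\sin\gamma}{2N\psi_uS_c\gamma}\,mF(t)+2m^2A(t).$$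 Then $$\frac{d}{dt}\mathcal{E}_1(t)\le 2(D(\Omega)+2K\psi_u\sin\alpha)-\frac{K\psi_l\cos\alpha\sin\gamma}{NS_c\gamma}\,\mathcal{E}_1(t)\qquad\text{for a.e. }0\le t<+\infty.$$
   Context: $N\ge 2$ is an integer, $m>0$ (inertia), $K>0$ (coupling strength), $0<\alpha<\frac{\pi}{2}$ (frustration), $\Omega_1,\dots,\Omega_N\in\mathbb{R}$ (natural frequencies). $\Psi=(\psi_{ij})$ is an $N\times N$ matrix with $\psi_{ij}\ge 0$, and $E=\{(j,i):\psi_{ij}>0\}$ is the edge set. The network is symmetric ($\psi_{ij}=\psi_{ji}$) and connected (any two vertices are joined by a path of edges in $E$). The phases satisfy $\theta_i(t)\in\mathbb{R}$; $\omega_i=\dot\theta_i$, $a_i=\dot\omega_i$. Solutions are real-analytic in $t$. Notation: $D_\theta(t)=\max_i\theta_i(t)-\min_i\theta_i(t)$, $D_\omega(t)=\max_i\omega_i(t)-\min_i\omega_i(t)$, $D(\Omega)=\max_i\Omega_i-\min_i\Omega_i$, $\psi_u=\max_{(i,j)\in E}\psi_{ji}$, $\psi_l=\min_{(i,j)\in E}\psi_{ji}$. For $z=(z_1,\dots,z_N)\in\mathbb{R}^N$ let $l_1\cdots l_N$ be a permutation of $\{1,\dots,N\}$ with $z_{l_1}\le\cdots\le z_{l_N}$ and set $$Y_c(z)=\bar z-\underline z,\quad \bar z=\frac{1}{S_c}\sum_{i=1}^Nc^{i-1}z_{l_i},\quad \underline z=\frac{1}{S_c}\sum_{i=1}^Nc^{N-i}z_{l_i}.$$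 Then $Q(t)=Y_c(\theta(t))$, $F(t)=Y_c(\omega(t))$, $A(t)=Y_c(a(t))$, where $\theta=(\theta_1,\dots,\theta_N)$, $\omega=(\omega_1,\dots,\omega_N)$, $a=(a_1,\dots,a_N)$ (each with its own, time-dependent ordering permutation). These are locally Lipschitz functions of $t$. *)

(* Defs.v *)
From HB Require Import structures.
From mathcomp Require Export all_boot all_order all_fingroup all_algebra.
From mathcomp Require Export all_classical all_reals all_analysis.

Set Implicit Arguments.
Unset Strict Implicit.
Unset Printing Implicit Defensive.

Export Order.TTheory GRing.Theory Num.Theory.
Export numFieldNormedType.Exports.

Local Open Scope classical_set_scope.
Local Open Scope ring_scope.

Section Diameter.
Variables (R : realType) (N : nat).
Implicit Types z : 'I_N -> R.

(* The range is finite, so for N > 0 the sup is a max and the inf is a min. *)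
Definition diam z : R := sup (range z) - inf (range z).

(* ordered z k is z_{l_(k+1)}: the value does not depend on the choice of the
   ordering permutation l, see orderedE. *)
Definition ordered z (k : 'I_N) : R :=
  nth 0 (sort <=%R [seq z i | i <- enum 'I_N]) k.

Lemma orderedE z (l : {perm 'I_N}) :
  (forall i j : 'I_N, (i <= j)%N -> z (l i) <= z (l j)) ->
  forall k, ordered z k = z (l k).
Proof.
move=> zl k; rewrite /ordered.
have -> : sort <=%R [seq z i | i <- enum 'I_N] = [seq z (l i) | i <- enum 'I_N].
  apply: (@le_sorted_eq _ R).
  - exact: sort_le_sorted.
  - rewrite sorted_map; apply: (@sub_sorted _ (relpre val leq)).
      by move=> i j; exact: zl.
    by rewrite -sorted_map val_enum_ord iota_sorted.
  - rewrite perm_sort (map_comp z l) perm_sym; apply: perm_map.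
    apply: uniq_perm; rewrite ?(map_inj_uniq perm_inj) ?enum_uniq// => i.
    by rewrite mem_enum -[i](permKV l) map_f// mem_enum.
by rewrite (nth_map k) ?size_enum_ord// nth_ord_enum.
Qed.

Variable c : R.

Definition S_ : R := \sum_(n < N) c ^+ n.

(* The index k runs from 0, so c^(i-1) and c^(N-i) become
   c ^+ k and c ^+ (N.-1 - k). *)
Definition upper_avg z : R := S_^-1 * \sum_(k < N) c ^+ k * ordered z k.

Definition lower_avg z : R := S_^-1 * \sum_(k < N) c ^+ (N.-1 - k) * ordered z k.

Definition Y z : R := upper_avg z - lower_avg z.

Definition eta : R := 1 - 2 / c.

End Diameter.

Arguments S_ {R} N c.

Section Network.
Variables (R : realType) (N : nat) (psi : 'M[R]_N).

(* edge j i means (j, i) \in E *)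
Definition edge : rel 'I_N := [rel j i | 0 < psi i j].

Definition symmetric_network : Prop := forall i j, psi i j = psi j i.

Definition connected_network : Prop := forall i j, connect edge i j.

Definition edge_weights : set R :=
  [set psi p.2 p.1 | p in [set p : 'I_N * 'I_N | edge p.1 p.2]].

(* E is finite, so these are a max and a min as soon as E is nonempty. *)
Definition psi_u : R := sup edge_weights.

Definition psi_l : R := inf edge_weights.

End Network.

Section InertialKuramoto.
Variables (R : realType) (N : nat).
Implicit Types theta omega : 'I_N -> R -> R.

(* theta and omega are functions on the whole line, but only their values on
   [0, +oo[ are constrained: derivable_oy_Rcontinuous f 0 says that f is
   differentiable on ]0, +oo[ and right-continuous at 0. *)
Definition is_solution (m K alpha : R) (Omega : 'I_N -> R) (psi : 'M[R]_N)
    theta omega : Prop :=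
  forall i,
    [/\ derivable_oy_Rcontinuous (theta i) 0,
        derivable_oy_Rcontinuous (omega i) 0,
        forall t, 0 < t -> derive1 (theta i) t = omega i t &
        forall t, 0 < t ->
          m * derive1 (omega i) t + omega i t =
          Omega i + K / N%:R *
            \sum_(j < N) psi i j * sin (theta j t - theta i t + alpha)].

Definition Q (c : R) theta (t : R) : R := Y c (fun i => theta i t).

Definition F (c : R) omega (t : R) : R := Y c (fun i => omega i t).

Definition A (c : R) omega (t : R) : R := Y c (fun i => derive1 (omega i) t).

Definition E1 (m c gamma : R) (psi : 'M[R]_N) theta omega (t : R) : R :=
  Q c theta t
  + eta c * psi_l psi * sin gamma / (2 * N%:R * psi_u psi * S_ N c * gamma)
    * (m * F c omega t)
  + 2 * m ^+ 2 * A c omega t.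

End InertialKuramoto.

(* Main.v *)
(**
Since the weights [c^k - c^(N-1-k)] increase with [k], [Y_c z] is the maximum over
all permutations [l] of the linear forms [Y_perm l z].  Hence [E1] is the maximum
of finitely many functions, indexed by triples of permutations and differentiable
for [t > 0]: it is differentiable off the countable set of isolated crossings, and
its derivative there is that of any member attaining the maximum.

For such a member, put B = D(Omega) + 2 K psi_u sin alpha, let mu be the
coefficient of mF in E1 and k = K psi_l cos alpha sin gamma / (N S_c gamma).
Applying the linear forms to the equation of motion and to its time derivative
gives, as long as D_theta <= gamma,
<<
      Q' <= B - 2 k Q + m A,
  mu m F' <= - mu F + B + k Q,
 2 m^2 A' <= - 2 m A + (mu / 2) F,
>>
which add up to E1' <= 2 B - k E1.  Condition (1) says E1(0) < beta, and
2 B < k beta, so E1 stays below beta; as eta D_theta <= Q <= E1 and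
eta > beta / gamma, the bound D_theta <= gamma never fails.
*)
Require Import Defs.
From mathcomp Require Import ring lra zify.

Set Implicit Arguments.
Unset Strict Implicit.
Unset Printing Implicit Defensive.

Local Open Scope classical_set_scope.
Local Open Scope ring_scope.

(** * The weights of [Y_c] and the linear forms whose maximum it is *)

Section Weights.
Variables (R : realType) (N : nat) (c : R).
Hypotheses (N_gt0 : (0 < N)%N) (c_gt2 : 2 < c).

Definition weight (k : nat) : R := (c ^+ k - c ^+ (N.-1 - k)) / S_ N c.

Definition Y_perm (l : {perm 'I_N}) (z : 'I_N -> R) : R :=
  \sum_(k < N) weight k * z (l k).

Lemma S_ge1 : 1 <= S_ N c.
Proof.
have c2 := c_gt2; rewrite /S_; case: N N_gt0 => // n _; rewrite big_ord_recl expr0 lerDl.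
by apply: sumr_ge0 => i _; apply: exprn_ge0; lra.
Qed.

Lemma S_gt0 : 0 < S_ N c.
Proof. exact: lt_le_trans S_ge1. Qed.

(** Since c > 2, distinct powers of [c] differ by at least 1. Both c^k - c^j and c^(N-1-j) -
    c^(N-1-k) gain this gap, whence the 2. *)
Lemma weightB (j k : nat) : (j < k)%N -> (k < N)%N ->
  2 / S_ N c <= weight k - weight j.
Proof.
move=> jk kN; rewrite /weight -mulrBl ler_pM2r ?invr_gt0 ?S_gt0//.
have c2 := c_gt2; have c1 : 1 <= c by lra.
have h (a b : nat) : (a < b)%N -> 1 <= c ^+ b - c ^+ a.
  move=> ab; have -> : b = (a + (b - a.+1).+1)%N by lia.
  rewrite exprD exprS.
  have a1 : 1 <= c ^+ a by apply: exprn_ege1.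
  have b1 : 1 <= c ^+ (b - a.+1) by apply: exprn_ege1.
  have : 2 <= c * c ^+ (b - a.+1) by nra.
  nra.
have := h j k jk; have : 1 <= c ^+ (N.-1 - j) - c ^+ (N.-1 - k) by apply: h; lia.
lra.
Qed.

Lemma weight_rev (k : 'I_N) : weight (rev_ord k) = - weight k.
Proof.
rewrite /weight /= -mulNr opprB.
have -> : (N.-1 - (N - k.+1))%N = k by have := ltn_ord k; lia.
by have -> : (N - k.+1 = N.-1 - k)%N by have := ltn_ord k; lia.
Qed.

Lemma Y_perm_ordered (z : 'I_N -> R) (l : {perm 'I_N}) :
  (forall i j : 'I_N, (i <= j)%N -> z (l i) <= z (l j)) -> Y_perm l z = Y c z.
Proof.
move=> zl; rewrite /Y /upper_avg /lower_avg -mulrBr -sumrB mulr_sumr.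
apply: eq_bigr => k _; rewrite (orderedE zl) /weight; ring.
Qed.

(* Exchanging two misplaced entries would increase the sum. *)
Lemma Y_perm_max_sorted (z : 'I_N -> R) (l : {perm 'I_N}) :
    (forall l', Y_perm l' z <= Y_perm l z) ->
  forall i j : 'I_N, (i <= j)%N -> z (l i) <= z (l j).
Proof.
move=> lmax i j; rewrite leq_eqVlt => /orP[/eqP/val_inj->//|ij].
have iNj : j != i by rewrite -val_eqE /= neq_ltn ij orbT.
have := lmax (tperm i j * l)%g; rewrite /Y_perm.
rewrite (bigD1 i)//= (bigD1 j)//= [leRHS](bigD1 i)//= [X in _ <= _ + X](bigD1 j)//=.
rewrite !permM tpermL tpermR.
rewrite (eq_bigr (fun k : 'I_N => weight k * z (l k))); last first.
  by move=> k /andP[ki kj]; rewrite permM tpermD// eq_sym.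
have := weightB ij (ltn_ord j).
have : 0 < 2 / S_ N c by rewrite divr_gt0 ?S_gt0.
set s := \sum_(_ < _ | _) _; nra.
Qed.

(** There are finitely many permutations, so one maximises the form. It sorts [z], and a sorting
    permutation gives the value [Y c z]. *)
Lemma Y_permP (z : 'I_N -> R) :
  (forall l, Y_perm l z <= Y c z) /\ exists l, Y_perm l z = Y c z.
Proof.
pose l := [arg max_(l > (1%g : {perm 'I_N})) Y_perm l z]%O.
have lmax l' : Y_perm l' z <= Y_perm l z.
  by rewrite /l; case: arg_maxP => // i _; apply.
have lY : Y_perm l z = Y c z by apply/Y_perm_ordered/Y_perm_max_sorted.
by split; [rewrite -lY|exists l].
Qed.

Lemma Y_perm_le_Y l (z : 'I_N -> R) : Y_perm l z <= Y c z.
Proof. by have [+ _] := Y_permP z; apply. Qed.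

Lemma Y_perm_sorted l (z : 'I_N -> R) : Y_perm l z = Y c z ->
  forall i j : 'I_N, (i <= j)%N -> z (l i) <= z (l j).
Proof. by move=> lz; apply: Y_perm_max_sorted => l'; rewrite lz Y_perm_le_Y. Qed.

(** Reversing the ranks changes the sign of every weight, so the negated form is again one of the
    forms. *)
Lemma Y_perm_geNY l (z : 'I_N -> R) : - Y c z <= Y_perm l z.
Proof.
pose r := perm (@rev_ord_inj N).
rewrite lerNl (le_trans _ (Y_perm_le_Y (r * l)%g z))// /Y_perm -sumrN.
rewrite (reindex_inj rev_ord_inj) /= le_eqVlt; apply/orP; left; apply/eqP.
apply: eq_bigr => k _; rewrite permM permE.
by have /= -> := weight_rev k; rewrite mulNr opprK.
Qed.

(** The form is a difference of two weighted means, with weights [u] and [v] of the same total mass.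
    It is therefore the mean of the differences z (l i) - z (l j) under the product weights u i * v
    j. *)
Lemma Y_perm_le l (z : 'I_N -> R) d : (forall i j, z i - z j <= d) ->
  Y_perm l z <= d.
Proof.
move=> zd; have c2 := c_gt2; have S0 := S_gt0.
pose u (k : 'I_N) := c ^+ k; pose v (k : 'I_N) := c ^+ (N.-1 - k).
have su : \sum_k u k = S_ N c by [].
have sv : \sum_k v k = S_ N c.
  rewrite /S_ (reindex_inj rev_ord_inj); apply: eq_bigr => k _.
  by rewrite /v; congr (_ ^+ _); rewrite /=; have := ltn_ord k; lia.
have c0 k : 0 <= c ^+ k by apply: exprn_ge0; lra.
rewrite -(ler_pM2r (mulr_gt0 S0 S0)).
have -> : Y_perm l z * (S_ N c * S_ N c) =
   \sum_i \sum_j u i * v j * (z (l i) - z (l j)).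
  rewrite mulrA /Y_perm mulr_suml.
  under eq_bigr do rewrite /weight mulrAC divfK ?gt_eqF//.
  rewrite mulr_suml.
  transitivity (\sum_i (u i * z (l i) * S_ N c) - \sum_i (v i * z (l i) * S_ N c)).
    by rewrite -sumrB; apply: eq_bigr => i _; rewrite /u /v; ring.
  rewrite -{1}sv -su.
  under eq_bigr do rewrite mulr_sumr.
  rewrite -[X in _ - X]mulr_suml mulrC big_distrlr /= -sumrB.
  by apply: eq_bigr => i _; rewrite -sumrB; apply: eq_bigr => j _; ring.
have -> : d * (S_ N c * S_ N c) = \sum_i \sum_j u i * v j * d.
  rewrite -{1}su -sv big_distrlr /= mulrC mulr_suml.
  by apply: eq_bigr => i _; rewrite mulr_suml.
do 2!(apply: ler_sum => ? _); apply: ler_wpM2l => //.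
by rewrite mulr_ge0// /u /v.
Qed.

Lemma Y_permD l (x y : 'I_N -> R) :
  Y_perm l (fun i => x i + y i) = Y_perm l x + Y_perm l y.
Proof. by rewrite /Y_perm -big_split; apply: eq_bigr => i _; rewrite mulrDr. Qed.

Lemma Y_permZ l a (x : 'I_N -> R) :
  Y_perm l (fun i => a * x i) = a * Y_perm l x.
Proof. by rewrite /Y_perm mulr_sumr; apply: eq_bigr => i _; rewrite mulrCA. Qed.

(** By the geometric sum, the largest power carries at least the fraction 1 - 1/c of the mass
    [S_ N c]. With D = max z - min z, the upper average is thus at least min z + (1 - 1/c) D and the
    lower one at most max z - (1 - 1/c) D. They differ by at least (1 - 2/c) D. *)
Lemma eta_diff_le_Y (z : 'I_N -> R) i j : eta c * (z i - z j) <= Y c z.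
Proof.
have c2 := c_gt2; have S0 := S_gt0.
have [_ [l lz]] := Y_permP z; have zl := Y_perm_sorted lz; rewrite -lz.
have zN : (N.-1 < N)%N by rewrite prednK.
pose a := Ordinal N_gt0; pose b := Ordinal zN.
have za k : z (l a) <= z k by rewrite -[k](permKV l); apply: zl.
have zb k : z k <= z (l b).
  by rewrite -[k](permKV l); apply: zl => /=; have := ltn_ord ((l^-1)%g k); lia.
set D := z (l b) - z (l a).
have D0 : 0 <= D by rewrite subr_ge0.
have eta0 : 0 <= eta c by rewrite /eta subr_ge0 ler_pdivrMr; lra.
apply: (@le_trans _ _ (eta c * D)).
  by apply: ler_wpM2l => //; rewrite lerB.
have c0 : 0 < c by lra.
have geo : (c - 1) * S_ N c = c ^+ N - 1 by rewrite subrX1.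
have top : (1 - c^-1) * S_ N c <= c ^+ N.-1.
  rewrite -(ler_pM2l c0) -exprS prednK// mulrA mulrBr mulr1 divff ?gt_eqF// geo.
  lra.
have ck k : 0 <= c ^+ k by apply: exprn_ge0; lra.
pose v (k : 'I_N) := c ^+ (N.-1 - k).
have sv : \sum_k v k = S_ N c.
  rewrite /S_ (reindex_inj rev_ord_inj); apply: eq_bigr => k _.
  by rewrite /v; congr (_ ^+ _); rewrite /=; have := ltn_ord k; lia.
have up : c ^+ N.-1 * D + S_ N c * z (l a) <= \sum_(k < N) c ^+ k * z (l k).
  have -> : c ^+ N.-1 = c ^+ b by [].
  rewrite -lerBrDr {1}/S_ mulr_suml -sumrB (bigD1 b)//.
  set T := \sum_(_ < _ | _) _; suff : 0 <= T by rewrite /D /=; lra.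
  by apply: sumr_ge0 => k _; rewrite -mulrBr mulr_ge0// subr_ge0.
have low : \sum_(k < N) v k * z (l k) <= S_ N c * z (l b) - c ^+ N.-1 * D.
  have -> : c ^+ N.-1 = v a by rewrite /v /= subn0.
  rewrite lerBrDr -lerBrDl -sv mulr_suml -sumrB (bigD1 a)//.
  set T := \sum_(_ < _ | _) _; suff : 0 <= T by rewrite /D /=; lra.
  by apply: sumr_ge0 => k _; rewrite -mulrBr mulr_ge0 ?subr_ge0// /v.
have -> : Y_perm l z =
    (\sum_(k < N) c ^+ k * z (l k) - \sum_(k < N) v k * z (l k)) / S_ N c.
  rewrite -sumrB mulr_suml; apply: eq_bigr => k _.
  by rewrite /weight /v; ring.
rewrite ler_pdivlMr//.
have : S_ N c * z (l b) - S_ N c * z (l a) = S_ N c * D by rewrite -mulrBr.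
have -> : eta c = 2 * (1 - c^-1) - 1 by rewrite /eta; ring.
have := ler_wpM2r D0 top.
nra.
Qed.

End Weights.

(** * Elementary bounds on the sine *)

Section Sine.
Variable R : realType.
Implicit Types x g : R.

Lemma sin_le_id x : 0 <= x -> sin x <= x.
Proof.
move=> x0; have [|y _] := @MVT_segment R sin cos 0 x x0 (fun y _ => is_derive_sin y).
  by apply: continuous_subspaceT; exact: continuous_sin.
rewrite sin0 !subr0 => ->.
by rewrite ler_piMl// (le_trans (ler_norm _))// cos_max.
Qed.

Lemma normr_sin_le x : `|sin x| <= `|x|.
Proof.
wlog x0 : x / 0 <= x => [hw|].
  have [/hw//|/ltW x0] := leP 0 x.
  by rewrite -normrN -sinN -(normrN x); apply: hw; rewrite oppr_ge0.
rewrite (ger0_norm x0) ler_norml sin_le_id// andbT.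
have [xpi|] := leP x 1.
  rewrite (@le_trans _ _ 0) ?oppr_le0// sin_ge0_pi// x0/=.
  by rewrite (le_trans xpi)// (le_trans _ (pi_ge2 _))// ler1n.
by move=> /ltW x1; rewrite lerNl (le_trans _ x1)// lerNl sin_geN1.
Qed.

(* The slope of the chord of [sin] on [[0, x]] dominates that on [[x, g]]. *)
Lemma sin_chord x g : 0 <= x <= g -> g < pi -> x * sin g <= g * sin x.
Proof.
move=> /andP[x0 xg] gpi.
have csin (a b : R) : {within `[a, b], continuous (@sin R)}.
  by apply: continuous_subspaceT; exact: continuous_sin.
have [y + E1] := @MVT_segment R sin cos 0 x x0 (fun y _ => is_derive_sin y) (csin _ _).
have [z + E2] := @MVT_segment R sin cos x g xg (fun y _ => is_derive_sin y) (csin _ _).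
rewrite !in_itv /= => /andP[xz zg] /andP[y0 yx].
have cyz : cos z <= cos y.
  by rewrite leNgt ltr_cos ?in_itv/= -?leNgt; try apply/andP; [|split|split]; lra.
rewrite sin0 !subr0 in E1.
have -> : sin g = sin x + cos z * (g - x) by lra.
rewrite E1 -subr_ge0.
have -> : g * (cos y * x) - x * (cos y * x + cos z * (g - x)) =
  x * (g - x) * (cos y - cos z) by ring.
by rewrite !mulr_ge0 ?subr_ge0.
Qed.

End Sine.

(** * Variation of a function along a path in a graph *)

Section PathVariation.
Variables (R : realDomainType) (T : finType) (e : rel T) (x : T -> R) (h : T -> T -> R).
Hypotheses (h_ge0 : forall i j, 0 <= h i j) (h_sym : forall i j, h i j = h j i).
Hypothesis h_edge : forall i j, e i j -> `|x i - x j| <= h i j.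

(** Each edge of the path occurs in the double sum in both orientations, whence the factor 2. As
    vertices do not repeat, peeling off the first one removes its own row and column and leaves the
    sum for the rest of the path. *)
Lemma uniq_path_variation u p : path e u p -> uniq (u :: p) ->
  2 * `|x u - x (last u p)| <= \sum_(i <- u :: p) \sum_(j <- u :: p) h i j.
Proof.
elim: p u => [|v p IH] u /=.
  by move=> _ _; rewrite subrr normr0 mulr0 !big_cons !big_nil !addr0.
move=> /andP[euv pp] /andP[uvp Uvp]; have {IH} := IH v pp Uvp.
set w := last v p; set s := v :: p => IH.
have -> : \sum_(i <- u :: s) \sum_(j <- u :: s) h i j =
    h u u + 2 * \sum_(j <- s) h u j + \sum_(i <- s) \sum_(j <- s) h i j.
  have split_u (F : T -> R) : \sum_(i <- u :: s) F i = F u + \sum_(i <- s) F i.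
    by rewrite big_cons.
  rewrite !split_u; under [X in _ + X]eq_bigr => i _ do rewrite split_u h_sym.
  by rewrite big_split /=; ring.
have huv : h u v <= \sum_(j <- s) h u j.
  by rewrite /s big_cons lerDl sumr_ge0.
have := h_edge euv; have := ler_distD (x v) (x u) (x w); have := h_ge0 u u.
lra.
Qed.

(** Any path can be shortened to a simple one. Nonnegativity of [h] then allows the sum to be
    extended to all vertices. *)
Lemma connect_variation u v : connect e u v ->
  2 * `|x u - x v| <= \sum_i \sum_j h i j.
Proof.
move=> /connectP[p + ->] => /shortenP[q eq Uq _].
apply: (le_trans (uniq_path_variation eq Uq)).
have sub (F : T -> R) : (forall i, 0 <= F i) ->
    \sum_(i <- u :: q) F i <= \sum_i F i.
  move=> F0; rewrite big_uniq//= [leRHS](bigID (mem (u :: q)))/= lerDl.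
  exact: sumr_ge0.
apply: le_trans (sub _ _); last by move=> i; apply: sumr_ge0.
by apply: ler_sum => i _; apply: sub.
Qed.

End PathVariation.

(** * Extremal edge weights of a connected network *)

Section Network.
Variables (R : realType) (N : nat) (psi : 'M[R]_N).
Hypotheses (N_ge2 : (2 <= N)%N) (psi_ge0 : forall i j, 0 <= psi i j).
Hypothesis psi_conn : connected_network psi.

(** As N >= 2, the vertices 0 and 1 are distinct, so a path joining them has a first edge. This
    makes [psi_u] and [psi_l] extrema of a nonempty set. *)
Lemma exists_edge : exists i j, 0 < psi i j.
Proof.
have N0 : (0 < N)%N by apply: leq_trans N_ge2.
have /connectP[[|k p]/=] := psi_conn (Ordinal N0) (Ordinal N_ge2).
  by move=> _ /(congr1 val).
by move=> /andP[e _ _]; exists k, (Ordinal N0).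
Qed.

Lemma edge_weightsP w : edge_weights psi w <-> exists i j, 0 < psi i j /\ w = psi i j.
Proof.
split=> [[[i j]/= e <-]|[i [j [e ->]]]]; first by exists j, i.
by exists (j, i).
Qed.

Let weights_neq0 : edge_weights psi !=set0.
Proof.
by have [i [j e]] := exists_edge; exists (psi i j); apply/edge_weightsP; exists i, j.
Qed.

(** A largest entry of the matrix dominates some edge, hence is itself an edge weight; the bound
    therefore covers pairs that are not edges. *)
Lemma le_psi_u i j : psi i j <= psi_u psi.
Proof.
have [a [b ab]] := exists_edge.
pose M := [arg max_(p > (a, b)) psi p.1 p.2]%O.
have hM p : psi p.1 p.2 <= psi M.1 M.2.
  by rewrite /M; case: arg_maxP => // q _; apply.
rewrite (le_trans (hM (i, j)))// ub_le_sup//.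
  by exists (psi M.1 M.2) => w /edge_weightsP[k [l [_ ->]]]; apply: (hM (k, l)).
by apply/edge_weightsP; exists M.1, M.2; split=> //; apply: lt_le_trans (hM (a, b)).
Qed.

Lemma psi_l_le i j : 0 < psi i j -> psi_l psi <= psi i j.
Proof.
move=> e; apply: ge_inf; last by apply/edge_weightsP; exists i, j.
by exists 0 => w /edge_weightsP[k [l [/ltW ? ->]]].
Qed.

Lemma psi_l_gt0 : 0 < psi_l psi.
Proof.
have [a [b ab]] := exists_edge.
pose M := [arg min_(p < (a, b) | (0 < psi p.1 p.2)) psi p.1 p.2]%O.
have [M0 hM] : 0 < psi M.1 M.2 /\ forall p, 0 < psi p.1 p.2 -> psi M.1 M.2 <= psi p.1 p.2.
  by rewrite /M; case: arg_minP.
apply: (lt_le_trans M0); apply: lb_le_inf => // w /edge_weightsP[i [j [e ->]]].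
exact: hM (i, j) e.
Qed.

Lemma psi_l_le_u : psi_l psi <= psi_u psi.
Proof. by have [i [j /psi_l_le/le_trans]] := exists_edge; apply; apply: le_psi_u. Qed.

End Network.

(** * Differences are bounded by the diameter *)

Section Diam.
Variables (R : realType) (N : nat).
Implicit Type z : 'I_N -> R.

Lemma le_diam z i j : z i - z j <= diam z.
Proof.
have bd (s : R) : exists b, forall k, s * z k <= b.
  pose M := [arg max_(k > i) (s * z k)]%O.
  by exists (s * z M) => k; rewrite /M; case: arg_maxP => // l _; apply.
have [b zb] := bd 1; have [b' zb'] := bd (-1).
apply: lerB.
  by apply: ub_le_sup; [exists b => _ [k _ <-]; rewrite -[z k]mul1r|exists i].
apply: ge_inf; [exists (- b') => _ [k _ <-]|by exists j].
by rewrite lerNl -mulN1r.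
Qed.

End Diam.

(** * Dissipation and size of the coupling term *)

Section Coupling.
Variables (R : realType) (N : nat) (psi : 'M[R]_N) (c : R).
Hypotheses (N_ge2 : (2 <= N)%N) (psi_ge0 : forall i j, 0 <= psi i j).
Hypothesis psi_conn : connected_network psi.
Hypothesis c_gt2 : 2 < c.

Let N_gt0 : (0 < N)%N. Proof. exact: ltn_trans N_ge2. Qed.

(* By symmetry of [psi] the left-hand side is minus half the sum of the terms
   [(W i - W j) * psi i j * sin (z i - z j) >= 0]; those along a simple path from
   an argmin to an argmax of [z] already control [Y c z <= max z - min z]. *)
Lemma sine_coupling_le (g : R) (z : 'I_N -> R) (l : {perm 'I_N}) :
    symmetric_network psi -> 0 < g < pi -> (forall i j, z i - z j <= g) ->
    (forall i j : 'I_N, (i <= j)%N -> z (l i) <= z (l j)) ->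
  Y_perm c l (fun i => \sum_j psi i j * sin (z j - z i)) <=
  - (2 * psi_l psi * sin g / (S_ N c * g)) * Y c z.
Proof.
move=> psi_sym /andP[g0 gpi] zg zl.
have S0 := S_gt0 N_gt0 c_gt2.
have sg0 : 0 < sin g by apply: sin_gt0_pi; rewrite g0.
have psil0 := psi_l_gt0 N_ge2 psi_conn.
pose W i := weight N c ((l^-1)%g i).
have YW x : Y_perm c l x = \sum_i W i * x i.
  rewrite [RHS](reindex_inj (@perm_inj _ l)); apply: eq_bigr => k _.
  by rewrite /W permK.
pose s i j := (W i - W j) * sin (z i - z j).
(* The first factor is the minimal gap between weights from [weightB], the second the slope of the
   chord of sin on [0, g]. *)
pose a := 2 / S_ N c * (sin g / g).
have a0 : 0 <= a by rewrite /a !mulr_ge0// ?invr_ge0 ltW.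
have sP i j : a * `|z i - z j| <= s i j.
  (* Both sides are symmetric in [i] and [j], so [i] may be given the higher rank. Weight and phase
     then increase together. *)
  wlog ij : i j / ((l^-1)%g j <= (l^-1)%g i)%N => [hw|].
    have [/hw//|/ltnW/hw] := leqP ((l^-1)%g j) ((l^-1)%g i).
    by rewrite distrC /s -[z j - z i]opprB sinN mulrN -mulNr opprB.
  have zij : z j <= z i by have := zl _ _ ij; rewrite !permKV.
  rewrite ger0_norm ?subr_ge0// /s.
  move: ij; rewrite leq_eqVlt => /orP[/eqP/val_inj/perm_inj->|ij].
    by rewrite !subrr mulr0 sin0 mulr0.
  have wij : 2 / S_ N c <= W i - W j by apply: weightB.
  have sij : sin g / g * (z i - z j) <= sin (z i - z j).
    rewrite mulrAC ler_pdivrMr// mulrC [leRHS]mulrC.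
    by apply: sin_chord => //; rewrite subr_ge0 zij zg.
  rewrite /a -mulrA; apply: ler_pM => //; first by rewrite divr_ge0// ltW.
  by rewrite mulr_ge0 ?subr_ge0 ?divr_ge0 // ltW.
pose h i j := psi i j * s i j.
have s0 i j : 0 <= s i j by rewrite (le_trans _ (sP i j))// mulr_ge0.
have h0 i j : 0 <= h i j by rewrite mulr_ge0.
have hC i j : h i j = h j i.
  by rewrite /h psi_sym /s -[z i - z j]opprB sinN mulrN -mulNr opprB.
(* Scaling [z] by [a * psi_l psi] combines [sP] with the lower bound on edge weights into the edge
   hypothesis of [connect_variation]. *)
have hE i j : edge psi i j -> `|a * psi_l psi * z i - a * psi_l psi * z j| <= h i j.
  rewrite /edge /= => e; rewrite -mulrBr normrM (ger0_norm (mulr_ge0 a0 (ltW psil0))).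
  rewrite hC /h distrC [a * _]mulrC -mulrA; apply: ler_pM => //.
    exact: ltW.
    exact: mulr_ge0.
  exact: psi_l_le.
have sumh : Y_perm c l (fun i => \sum_j psi i j * sin (z j - z i)) =
    - (1 / 2) * \sum_i \sum_j h i j.
  rewrite YW.
  have -> : \sum_i \sum_j h i j = \sum_i \sum_j W i * (psi i j * sin (z i - z j)) -
     \sum_i \sum_j W j * (psi i j * sin (z i - z j)).
    rewrite -sumrB; apply: eq_bigr => i _; rewrite -sumrB; apply: eq_bigr => j _ .
    by rewrite /h /s; ring.
  rewrite [X in _ - X]exchange_big /=.
  have sC i j : psi i j * sin (z i - z j) = - (psi i j * sin (z j - z i)).
    by rewrite -[z i - z j]opprB sinN mulrN.
  have -> : \sum_i \sum_j W i * (psi i j * sin (z i - z j)) =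
     - \sum_i W i * \sum_j psi i j * sin (z j - z i).
    rewrite -sumrN; apply: eq_bigr => i _; rewrite mulr_sumr -sumrN.
    by apply: eq_bigr => j _; rewrite sC mulrN.
  have -> : \sum_j \sum_i W j * (psi i j * sin (z i - z j)) =
     \sum_i W i * \sum_j psi i j * sin (z j - z i).
    apply: eq_bigr => j _; rewrite mulr_sumr; apply: eq_bigr => i _.
    by rewrite psi_sym.
  by field.
have zN : (N.-1 < N)%N by rewrite prednK.
pose u := l (Ordinal zN); pose v := l (Ordinal N_gt0).
have Yuv : Y c z <= z u - z v.
  rewrite -(Y_perm_ordered c zl); apply: Y_perm_le => // i j.
  rewrite -[i](permKV l) -[j](permKV l) lerB//; apply: zl => //=.
  by have := ltn_ord ((l^-1)%g i); lia.
have := connect_variation (x := fun i => a * psi_l psi * z i) h0 hC hE (psi_conn u v).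
rewrite sumh -mulrBr normrM (ger0_norm (mulr_ge0 a0 (ltW psil0))) => H.
have -> : - (2 * psi_l psi * sin g / (S_ N c * g)) = - (a * psi_l psi).
  by rewrite /a; field; rewrite ?gt_eqF.
have : a * psi_l psi * Y c z <= a * psi_l psi * `|z u - z v|.
  apply: (ler_wpM2l (mulr_ge0 a0 (ltW psil0))).
  exact: le_trans Yuv (ler_norm _).
lra.
Qed.

Lemma coupling_norm_le (K b : R) (x : 'I_N -> R) i : 0 <= K ->
  (forall j, `|x j| <= b) ->
  `|K / N%:R * \sum_j psi i j * x j| <= K * psi_u psi * b.
Proof.
move=> K0 xb.
have N0 : 0 < N%:R :> R by rewrite ltr0n.
have b0 : 0 <= b by apply: le_trans (normr_ge0 _) (xb i).
rewrite normrM ger0_norm ?divr_ge0 ?ler0n//.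
have -> : K * psi_u psi * b = K / N%:R * \sum_(j < N) psi_u psi * b.
  by rewrite sumr_const card_ord -mulr_natl; field; rewrite gt_eqF.
apply: ler_wpM2l; first by rewrite divr_ge0 ?ler0n.
apply: (le_trans (ler_norm_sum _ _ _)); apply: ler_sum => j _.
by rewrite normrM ger0_norm// ler_pM// le_psi_u.
Qed.

End Coupling.

(** * Differential inequalities for the three parts of the energy *)

Section EnergyEstimates.
Variables (R : realType) (N : nat) (psi : 'M[R]_N) (c m K alpha : R).
Variables Omega th om a : 'I_N -> R.
Hypotheses (N_ge2 : (2 <= N)%N) (psi_ge0 : forall i j, 0 <= psi i j).
Hypotheses (psi_sym : symmetric_network psi) (psi_conn : connected_network psi).
Hypotheses (c_gt2 : 2 < c) (m_gt0 : 0 < m) (K_gt0 : 0 < K).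
Hypothesis alphaP : 0 < alpha < pi / 2.
Hypothesis motion : forall i, m * a i + om i =
  Omega i + K / N%:R * \sum_j psi i j * sin (th j - th i + alpha).

Let N_gt0 : (0 < N)%N. Proof. exact: ltn_trans N_ge2. Qed.

Let cos_alpha_gt0 : 0 < cos alpha.
Proof.
have /andP[a0 a1] := alphaP; apply: cos_gt0_pihalf.
by rewrite a1 andbT; lra.
Qed.

Let sin_alpha_gt0 : 0 < sin alpha.
Proof. exact: sin_gt0_pihalf. Qed.

Definition forcing := diam Omega + 2 * K * psi_u psi * sin alpha.
Definition decay_rate g := K * psi_l psi * cos alpha * sin g / (N%:R * S_ N c * g).

Let psi_u_gt0 : 0 < psi_u psi.
Proof. by apply: lt_le_trans (psi_l_gt0 N_ge2 psi_conn) _; apply: psi_l_le_u. Qed.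

Let eta_gt0 : 0 < eta c.
Proof. by have c2 := c_gt2; rewrite /eta subr_gt0 ltr_pdivrMr; lra. Qed.

Let SN i : \sum_j psi i j * sin (th j - th i + alpha) =
  cos alpha * (\sum_j psi i j * sin (th j - th i)) +
  sin alpha * (\sum_j psi i j * cos (th j - th i)).
Proof.
by rewrite !mulr_sumr -big_split; apply: eq_bigr => j _ /=; rewrite sinD; ring.
Qed.

(** The equation of motion is solved for [om] and sin (x + alpha) is expanded. The sin x part
    dissipates by [sine_coupling_le], the cos x part is bounded and joins the forcing, and the
    inertial term - m a costs at most m [Y c a] by [Y_perm_geNY]. *)
Lemma phase_estimate (g : R) (l : {perm 'I_N}) :
    0 < g < pi -> (forall i j, th i - th j <= g) ->
    (forall i j : 'I_N, (i <= j)%N -> th (l i) <= th (l j)) ->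
  Y_perm c l om <= forcing - 2 * decay_rate g * Y c th + m * Y c a.
Proof.
move=> gP thg thl; have /andP[g0 gpi] := gP.
pose C i := K / N%:R * \sum_j psi i j * cos (th j - th i).
pose s i := \sum_j psi i j * sin (th j - th i).
have -> : Y_perm c l om = Y_perm c l (fun i => Omega i + sin alpha * C i) +
    (K / N%:R * cos alpha) * Y_perm c l s + (- m) * Y_perm c l a.
  rewrite -!Y_permZ -!Y_permD; congr (Y_perm _ _ _); apply/funext => i.
  have -> : om i = m * a i + om i - m * a i by ring.
  by rewrite motion SN /C /s; ring.
have hC i : `|C i| <= K * psi_u psi * 1.
  by apply: coupling_norm_le => //; [exact: ltW|move=> j; exact: cos_max].
have : Y_perm c l (fun i => Omega i + sin alpha * C i) <= forcing.
  apply: Y_perm_le => // i j.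
  have := le_diam Omega i j; have := hC i; have := hC j; rewrite !ler_norml mulr1.
  move=> /andP[Cj _] /andP[_ Ci].
  have : sin alpha * (C i - C j) <= sin alpha * (2 * (K * psi_u psi)).
    by rewrite ler_pM2l//; lra.
  rewrite /forcing; lra.
have : (K / N%:R * cos alpha) * Y_perm c l s <= - (2 * decay_rate g * Y c th).
  have := sine_coupling_le N_ge2 psi_ge0 psi_conn c_gt2 psi_sym gP thg thl.
  have Kc : 0 < K / N%:R * cos alpha by rewrite !mulr_gt0// invr_gt0 ltr0n.
  rewrite -(ler_pM2l Kc) => /le_trans; apply; rewrite le_eqVlt; apply/orP; left.
  apply/eqP; rewrite /decay_rate; field.
  by rewrite ?pnatr_eq0 ?gt_eqF// ?S_gt0// ?ltr0n.
have : - m * Y_perm c l a <= m * Y c a.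
  have := Y_perm_geNY N_gt0 c_gt2 l a; rewrite -(ler_pM2l m_gt0); lra.
lra.
Qed.

(** Only |sin (x + alpha)| <= cos alpha |x| + sin alpha is used, so [l] need not order anything. The
    same inequality later bounds the acceleration part of the initial energy. *)
Lemma velocity_estimate (D : R) l : (forall i j, th i - th j <= D) ->
  m * Y_perm c l a <= - Y_perm c l om + forcing + 2 * K * psi_u psi * cos alpha * D.
Proof.
move=> thD.
have -> : m * Y_perm c l a = - 1 * Y_perm c l om + Y_perm c l (fun i => Omega i +
    K / N%:R * \sum_j psi i j * sin (th j - th i + alpha)).
  rewrite -!Y_permZ -!Y_permD; congr (Y_perm _ _ _); apply/funext => i.
  by rewrite -motion; ring.
rewrite mulN1r -addrA lerD2l.
pose b := cos alpha * D + sin alpha.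
have hb i : `|K / N%:R * \sum_j psi i j * sin (th j - th i + alpha)| <= K * psi_u psi * b.
  apply: coupling_norm_le => //; first exact: ltW.
  move=> j; rewrite sinD (le_trans (ler_normD _ _))// !normrM.
  rewrite (gtr0_norm cos_alpha_gt0) (gtr0_norm sin_alpha_gt0) /b.
  rewrite mulrC lerD// ?ler_pM2l//; last by rewrite ler_piMl ?cos_max// ltW.
  by rewrite (le_trans (normr_sin_le _))// ler_norml thD lerNl opprB thD.
apply: Y_perm_le => // i j.
have := le_diam Omega i j; have := hb i; have := hb j; rewrite !ler_norml.
move=> /andP[bj _] /andP[_ bi]; rewrite /b in bi bj; rewrite /forcing; lra.
Qed.

(** Here [b] stands for the derivative of [a], and its hypothesis is the differentiated equation of
    motion. As |cos| <= 1, each coupling is at most K psi_u D, and a difference of two of them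
    doubles this. *)
Lemma acceleration_estimate (b : 'I_N -> R) (D : R) l : (forall i j, om i - om j <= D) ->
    (forall i, m * b i + a i =
      K / N%:R * \sum_j psi i j * (cos (th j - th i + alpha) * (om j - om i))) ->
  m * Y_perm c l b <= - Y_perm c l a + 2 * K * psi_u psi * D.
Proof.
move=> omD hb.
have -> : m * Y_perm c l b = - 1 * Y_perm c l a + Y_perm c l (fun i =>
    K / N%:R * \sum_j psi i j * (cos (th j - th i + alpha) * (om j - om i))).
  rewrite -!Y_permZ -!Y_permD; congr (Y_perm _ _ _); apply/funext => i.
  by rewrite -hb; ring.
rewrite mulN1r lerD2l.
have hs i : `|K / N%:R * \sum_j psi i j * (cos (th j - th i + alpha) * (om j - om i))|
    <= K * psi_u psi * D.
  apply: coupling_norm_le => //; first exact: ltW.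
  move=> j; rewrite normrM; apply: (@le_trans _ _ `|om j - om i|).
    by rewrite ler_piMl ?cos_max.
  by rewrite ler_norml omD lerNl opprB omD.
apply: Y_perm_le => // i j.
have := hs i; have := hs j; rewrite !ler_norml; lra.
Qed.

Definition velocity_coef g := eta c * psi_l psi * sin g / (2 * N%:R * psi_u psi * S_ N c * g).

Lemma velocity_coef_bounds (g : R) : 0 < g < pi -> 0 < velocity_coef g <= 1.
Proof.
move=> /andP[g0 gpi].
have S0 := S_gt0 N_gt0 c_gt2; have S1 := S_ge1 N_gt0 c_gt2.
have sg0 : 0 < sin g by apply: sin_gt0_pi; rewrite g0.
have sg1 := sin_le_id (ltW g0).
have N0 : 0 < N%:R :> R by rewrite ltr0n.
have N1 : 1 <= N%:R :> R by rewrite ler1n.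
have l0 := psi_l_gt0 N_ge2 psi_conn; have lu := psi_l_le_u N_ge2 psi_conn.
have e1 : eta c <= 1.
  by rewrite /eta gerBl divr_ge0//; have := c_gt2; lra.
have u0 := psi_u_gt0; have e0 := eta_gt0.
rewrite /velocity_coef divr_gt0 ?mulr_gt0//= ler_pdivrMr ?mulr_gt0// mul1r.
have h1 : eta c * psi_l psi <= psi_u psi.
  by rewrite -[leRHS]mul1r ler_pM// ltW.
have h2 : eta c * psi_l psi * sin g <= psi_u psi * g.
  by apply: ler_pM => //; rewrite ?mulr_ge0 ?ltW.
have h3 : 1 <= 2 * N%:R * S_ N c :> R by nra.
have : 1 * (psi_u psi * g) <= 2 * N%:R * S_ N c * (psi_u psi * g).
  by rewrite ler_pM2r ?mulr_gt0.
lra.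
Qed.

(** The three estimates are added after weighting by 1, [velocity_coef g] and 2 m. The two bounds on
    m K make the cross terms fit into the damping. *)
Lemma energy_dissipation (b : 'I_N -> R) (g : R) (p q r : {perm 'I_N}) :
    0 < g < pi -> (forall i j, th i - th j <= g) ->
    m * K < eta c ^+ 2 * psi_l psi * sin g
      / (16 * N%:R * psi_u psi ^+ 2 * S_ N c * g) ->
    m * K < N%:R * S_ N c / (2 * psi_l psi) ->
    (forall i, m * b i + a i =
      K / N%:R * \sum_j psi i j * (cos (th j - th i + alpha) * (om j - om i))) ->
    (forall i j : 'I_N, (i <= j)%N -> th (p i) <= th (p j)) ->
    Y_perm c q om = Y c om -> Y_perm c r a = Y c a ->
  Y_perm c p om + velocity_coef g * (m * Y_perm c q a) + 2 * m ^+ 2 * Y_perm c r b <=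
  2 * forcing - decay_rate g * (Y c th + velocity_coef g * (m * Y c om) + 2 * m ^+ 2 * Y c a).
Proof.
move=> gP thg mK1 mK2 hb thp qE rE.
have /andP[g0 gpi] := gP; have /andP[mu0 mu1] := velocity_coef_bounds gP.
have S0 := S_gt0 N_gt0 c_gt2.
have sg0 : 0 < sin g by apply: sin_gt0_pi; rewrite g0.
have sg1 := sin_le_id (ltW g0).
have N0 : 0 < N%:R :> R by rewrite ltr0n.
have l0 := psi_l_gt0 N_ge2 psi_conn.
have u0 := psi_u_gt0; have e0 := eta_gt0; have ca0 := cos_alpha_gt0.
have m0 := m_gt0; have K0 := K_gt0.
have Dth i j : th i - th j <= Y c th / eta c.
  by rewrite ler_pdivlMr// mulrC eta_diff_le_Y.
have Dom i j : om i - om j <= Y c om / eta c.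
  by rewrite ler_pdivlMr// mulrC eta_diff_le_Y.
have Y0 (z : 'I_N -> R) : 0 <= Y c z.
  by have := eta_diff_le_Y N_gt0 c_gt2 z (Ordinal N_gt0) (Ordinal N_gt0); rewrite subrr mulr0.
have h1 := phase_estimate gP thg thp.
have h2 := velocity_estimate q Dth; rewrite qE in h2.
have h3 := acceleration_estimate r Dom hb; rewrite rE in h3.
have k0 : 0 < decay_rate g by rewrite /decay_rate divr_gt0 ?mulr_gt0.
have B0 : 0 <= forcing.
  have s0 := sin_alpha_gt0; rewrite /forcing addr_ge0//; last by rewrite !mulr_ge0// ltW.
  by have := le_diam Omega (Ordinal N_gt0) (Ordinal N_gt0); rewrite subrr.
(* After summation the damping mu/2 F + m A remains; this bound lets it cover the F and A parts of
   the decay term. *)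
have km : decay_rate g * m <= 1 / 2.
  have -> : decay_rate g * m =
      (m * K * psi_l psi / (N%:R * S_ N c)) * (cos alpha * (sin g / g)).
    by rewrite /decay_rate; field; rewrite ?gt_eqF.
  rewrite -[leRHS]mulr1; apply: ler_pM.
  - by rewrite divr_ge0 ?mulr_ge0 ?ltW.
  - by rewrite mulr_ge0 ?divr_ge0 ?ltW.
  - rewrite ler_pdivrMr ?mulr_gt0//.
    by move: mK2; rewrite ltr_pdivlMr ?mulr_gt0//; lra.
  - have cos1 : cos alpha <= 1 by rewrite (le_trans (ler_norm _))// cos_max.
    have sinc1 : sin g / g <= 1 by rewrite ler_pdivrMr// mul1r.
    rewrite -[leRHS]mulr1; apply: ler_pM => //; first exact: ltW.
    by rewrite divr_ge0// ltW.
(* The first bound on m K, multiplied by 4 psi_u / eta: half of the velocity damping pays for the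
   coupling in the acceleration estimate. *)
have muK : 4 * m * (K * psi_u psi / eta c) <= velocity_coef g / 2.
  have -> : 4 * m * (K * psi_u psi / eta c) = m * K * (4 * psi_u psi / eta c).
    by ring.
  have -> : velocity_coef g / 2 = eta c ^+ 2 * psi_l psi * sin g
      / (16 * N%:R * psi_u psi ^+ 2 * S_ N c * g) * (4 * psi_u psi / eta c).
    by rewrite /velocity_coef; field; rewrite ?gt_eqF.
  by rewrite ltW// ltr_pM2r// divr_gt0 ?mulr_gt0.
(* The velocity coefficient is tuned so that the phase term consumes exactly one of the two units of
   decay in [phase_estimate]. *)
have muk : velocity_coef g * (2 * K * psi_u psi * cos alpha * (Y c th / eta c)) =
    decay_rate g * Y c th.
  by rewrite /velocity_coef /decay_rate; field; rewrite ?gt_eqF.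
have {}h2 : velocity_coef g * (m * Y_perm c q a) <=
    - velocity_coef g * Y c om + forcing + decay_rate g * Y c th.
  rewrite -muk; have := ler_wpM2l (ltW mu0) h2.
  have : velocity_coef g * forcing <= forcing by rewrite ler_piMl.
  lra.
have {}h3 : 2 * m ^+ 2 * Y_perm c r b <= - 2 * m * Y c a + velocity_coef g / 2 * Y c om.
  have := ler_wpM2l (mulr_ge0 (ler0n R 2) (ltW m0)) h3.
  have := ler_wpM2r (Y0 om) muK; lra.
have h4 : decay_rate g * m * (velocity_coef g * Y c om) <= 1 / 2 * (velocity_coef g * Y c om).
  by rewrite ler_wpM2r// mulr_ge0// ltW.
have h5 : decay_rate g * m * (2 * m * Y c a) <= 1 / 2 * (2 * m * Y c a).
  by rewrite ler_wpM2r// !mulr_ge0// ltW.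
lra.
Qed.

End EnergyEstimates.

(** * Difference quotients and isolated zeros *)

Section RealDerivative.
Variable R : realType.
Implicit Types (f g : R -> R) (t d : R).

Lemma is_derive1P f t d : is_derive t 1 f d <->
  h^-1 * (f (h + t) - f t) @[h --> 0^'] --> d.
Proof.
have E : (fun h => h^-1 *: ((f \o shift t) (h *: 1) - f t)) =
         (fun h => h^-1 * (f (h + t) - f t)).
  by apply/funext => h; rewrite /= [h *: _]mulr1.
split=> [[df <-]|H]; first by rewrite -E; exact: df.
apply: DeriveDef; rewrite /derivable /derive E.
  by apply/cvg_ex; exists d.
exact: cvg_lim H.
Qed.

Lemma dnbhs0P (P : set R) : (\forall h \near 0^', P h) <->
  exists2 e, 0 < e & forall h, h != 0 -> `|h| < e -> P h.
Proof.
split=> [/nbhs_ballP[e /= e0 H]|[e e0 H]].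
  by exists e => // h h0 he; apply: H => //; rewrite /ball/= sub0r normrN.
apply/nbhs_ballP; exists e => //= h; rewrite /ball/= sub0r normrN => he h0.
exact: H.
Qed.

(** Near [t] the difference quotient is close to [d], hence nonzero, whereas another zero of [f]
    would make it vanish. *)
Lemma isolated_zero f t d : is_derive t 1 f d -> f t = 0 -> d != 0 ->
  isolated [set s | f s = 0] t.
Proof.
move=> /is_derive1P fd ft d0.
have /dnbhs0P[e e0 H] : \forall h \near 0^', h^-1 * (f (h + t) - f t) != 0.
  exact: cvgr_neq0 fd d0.
split; first exact/mem_set.
exists (ball t e); first exact: nbhsx_ballx.
apply/seteqP; split=> [s [/= bs fs]|_ ->]; last by split=> //; exact: ballxx.
apply/eqP; rewrite -subr_eq0; apply/negPn/negP => st.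
have /= := H (s - t) st; rewrite distrC => /(_ bs).
by rewrite subrK fs ft subrr mulr0 eqxx.
Qed.

End RealDerivative.

(** * Maxima of finitely many differentiable functions *)

Section FiniteMax.
Variables (R : realType) (I : finType) (f f' : I -> R -> R).
Hypothesis fE : forall i (t : R), 0 < t -> is_derive t 1 (f i) (f' i t).

(* Two members of the family with distinct derivatives agree only at isolated
   points. *)
Lemma finite_max_is_derive (M : R -> R) :
    (forall t : R, 0 < t -> (forall i, f i t <= M t) /\ exists i, M t = f i t) ->
  exists2 C : set R, countable C &
    forall t : R, 0 < t -> ~ C t ->
      exists2 i, f i t = M t & is_derive t 1 M (f' i t).
Proof.
move=> MP.
pose Z (p : I * I) := isolated [set s | f p.1 s - f p.2 s = 0].
exists (\bigcup_p Z p).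
  apply: bigcup_countable => [|p _]; last exact: countable_isolated.
  exact/finite_set_countable/finite_finset.
move=> t t0 nC; have [Mge [i Mi]] := MP t t0.
exists i => //; apply/is_derive1P/cvgrPdist_lt => e e0.
(* Off the isolated crossings, all members attaining the maximum at [t] have the same derivative. *)
have eqd j : f j t = M t -> f' j t = f' i t.
  move=> Mj; apply/eqP/negPn/negP => dij; apply: nC; exists (i, j) => //.
  apply: (@isolated_zero _ (f i - f j) t (f' i t - f' j t)).
  - by apply: is_deriveB; exact: fE.
  - by rewrite !fctE Mj Mi subrr.
  - by rewrite subr_eq0 eq_sym.
have cf j : {for t, continuous (f j)}.
  have dj := fE j t0.
  exact/differentiable_continuous/derivable1_diffP/ex_derive.
have shift_t : (h + t) @[h --> (0 : R)^'] --> t.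
  rewrite -[X in _ --> X]add0r; apply: cvgD; last exact: cvg_cst.
  exact: cvg_within.
have shiftc (g : R -> R) : {for t, continuous g} -> g (h + t) @[h --> 0^'] --> g t.
  by move=> cg; apply: cvg_comp shift_t cg.
(* Near [t], a member attaining the maximum has a good difference quotient, and any other stays
   strictly below [f i], so it cannot realise [M (h + t)]. *)
have : \forall h \near 0^', forall j, if f j t == M t
    then `|f' i t - h^-1 * (f j (h + t) - f j t)| < e
    else f j (h + t) < f i (h + t).
  apply: filter_forall => j; case: eqP => [Mj|/eqP Mj].
    rewrite -(eqd j Mj); move: e e0; apply/cvgrPdist_lt/is_derive1P; exact: fE.
  have ji : 0 < f i t - f j t by rewrite subr_gt0 lt_neqAle -Mi Mj Mge.
  have : \forall h \near 0^', 0 < f i (h + t) - f j (h + t).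
    by apply: (@cvgr_gt _ _ (0^') _ _ _ _ _ ji); apply: cvgB; apply: shiftc.
  by apply: filterS => h; rewrite subr_gt0.
have : \forall h \near 0^', 0 < h + t by apply: cvgr_gt shift_t _ t0.
apply: filterS2 => h ht H.
have [_ [k Mk]] := MP _ ht; have := H k; case: eqP => [Mtk|_].
  by rewrite Mk -Mtk.
by have [/(_ i) + _] := MP _ ht; rewrite Mk => /le_lt_trans/[apply]; rewrite ltxx.
Qed.

(** Let [u] be the first time at which some member reaches [b]. All members lie below [b] before
    [u], so the one touching [b] has nonnegative left difference quotients there, against its
    negative derivative. *)
Lemma finite_max_barrier (b : R) :
    (forall i, f i t @[t --> 0^'+] --> f i 0) -> (forall i, f i 0 < b) ->
    (forall t : R, 0 < t -> (forall i, f i t <= b) ->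
      forall i, f i t = b -> f' i t < 0) ->
  forall t : R, 0 <= t -> forall i, f i t < b.
Proof.
move=> f0c f0 fb t t0 i; rewrite ltNge; apply/negP => bi.
pose A := [set s : R | 0 <= s /\ exists i, b <= f i s].
have A0 : A !=set0 by exists t; split=> //; exists i.
have Alb : lbound A 0 by move=> s [].
have hA : has_lbound A by exists 0.
have fc j (s : R) : 0 < s -> f j x @[x --> s] --> f j s.
  move=> s0; have dj := fE j s0.
  exact/differentiable_continuous/derivable1_diffP/ex_derive.
pose u := inf A.
have u0 : 0 <= u by exact: lb_le_inf.
have below (s : R) j : 0 <= s -> s < u -> f j s < b.
  move=> s0 su; rewrite ltNge; apply/negP => bs.
  by have : u <= s by [apply: ge_inf => //; split=> //; exists j]; rewrite leNgt su.
(* The infimum is attained: otherwise all members are below [b] at [u], and by right continuity up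
   to some u + e, which would then be a lower bound of [A]. *)
have [_ [k bk]] : A u.
  apply: contrapT => nA.
  have fu j : f j u < b.
    by rewrite ltNge; apply/negP => bj; apply: nA; split=> //; exists j.
  have fr j : f j x @[x --> u^'+] --> f j u.
    move: u0; rewrite le_eqVlt => /predU1P[<-//|u0].
    by apply: cvg_at_right_filter; exact: fc.
  have : \forall x \near u^'+, forall j, f j x < b.
    by apply: filter_forall => j; apply: cvgr_lt (fr j) _ (fu j).
  move=> /nbhs_ballP[e /= e0 H].
  have : u + e <= u.
    apply: lb_le_inf => // s As; rewrite leNgt; apply/negP => se.
    have us : u <= s by exact: ge_inf.
    case: As => s0 [j]; rewrite leNgt => /negP; apply.
    move: us; rewrite le_eqVlt => /predU1P[<-//|us].
    by apply: H => //; rewrite /ball/= ltr_norml; apply/andP; split; lra.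
  by rewrite gerDl leNgt e0.
have up : 0 < u.
  rewrite lt_neqAle u0 andbT; apply/eqP => uE.
  by move: bk; rewrite -uE leNgt f0.
have fu j : f j u <= b.
  rewrite leNgt; apply/negP => bj.
  have Pb : \forall x \near u^'-, b < f j x.
    by apply: cvgr_gt bj; apply: cvg_at_left_filter; exact: fc.
  have Pu : \forall x \near u^'-, 0 < x < u.
    near=> x; apply/andP; split; near: x; first exact: nbhs_left_gt.
    exact: nbhs_left_lt.
  have [x [bx /andP[x0 xu]]] : exists x, b < f j x /\ 0 < x < u.
    by apply: (@filter_ex _ (u^'-)); exact: filterI.
  by have := lt_trans bx (below x j (ltW x0) xu); rewrite ltxx.
have ku : f k u = b by apply/eqP; rewrite eq_le fu.
have kd := fb u up fu k ku.
have /is_derive1P dk := fE k up.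
have /dnbhs0P[e e0 H] : \forall h \near 0^', h^-1 * (f k (h + u) - f k u) < 0.
  exact: cvgr_lt dk _ kd.
(* This keeps u - h nonnegative and within distance [e] of [u]. *)
pose h := Num.min (e / 2) u.
have h0 : 0 < h by rewrite lt_min divr_gt0.
have he : h <= e / 2 by rewrite ge_min lexx.
have hu : h <= u by rewrite ge_min lexx orbT.
have hN : - h != 0 by rewrite oppr_eq0 gt_eqF.
have := H _ hN; rewrite normrN gtr0_norm// => /(_ ltac:(lra)).
rewrite invrN mulNr oppr_lt0 pmulr_rgt0 ?invr_gt0// subr_gt0 ku => bh.
have := below (- h + u) k ltac:(lra) ltac:(lra).
by rewrite ltNge (ltW bh).
Unshelve. all: by end_near. Qed.

End FiniteMax.

(** * Derivatives and limits of the linear forms *)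

Section YPermLimits.
Variables (R : realType) (N : nat) (c : R) (l : {perm 'I_N}).

Lemma is_derive_Y_perm (x : 'I_N -> R -> R) (dx : 'I_N -> R) (t : R) :
    (forall i, is_derive t 1 (x i) (dx i)) ->
  is_derive t 1 (fun s => Y_perm c l (fun i => x i s)) (Y_perm c l dx).
Proof.
move=> xE; have -> : (fun s => Y_perm c l (fun i => x i s)) =
    \sum_(k < N) (weight N c k \*: x (l k)).
  by apply/funext => s; rewrite fct_sumE.
exact: is_derive_sum.
Qed.

Lemma cvg_Y_perm (F : set_system R) (x : 'I_N -> R -> R) (y : 'I_N -> R) :
    Filter F -> (forall i, x i s @[s --> F] --> y i) ->
  Y_perm c l (fun i => x i s) @[s --> F] --> Y_perm c l y.
Proof.
move=> FF xy; apply: cvg_big => [|k _]; first exact: add_continuous.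
apply: cvgM; [exact: cvg_cst|exact: xy].
Qed.

End YPermLimits.

(** * Regularity of the trajectory, its acceleration and its jerk *)

Section Trajectory.
Variables (R : realType) (N : nat) (psi : 'M[R]_N) (m K alpha : R).
Variables (Omega : 'I_N -> R) (theta omega : 'I_N -> R -> R).
Hypotheses (m_gt0 : 0 < m).
Hypothesis sol : is_solution m K alpha Omega psi theta omega.

(* The acceleration prescribed by the equation of motion; unlike
   [derive1 (omega i)] it is meaningful at time 0. *)
Definition accel i t : R := (Omega i + K / N%:R *
  (\sum_(j < N) psi i j * sin (theta j t - theta i t + alpha)) - omega i t) / m.

Definition jerk i t : R := (K / N%:R * (\sum_(j < N) psi i j *
  (cos (theta j t - theta i t + alpha) * (omega j t - omega i t))) - accel i t) / m.

Lemma accelE i t : m * accel i t + omega i t =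
  Omega i + K / N%:R * \sum_j psi i j * sin (theta j t - theta i t + alpha).
Proof. by rewrite /accel mulrC divfK ?gt_eqF// subrK. Qed.

Lemma jerkE i t : m * jerk i t + accel i t = K / N%:R *
  \sum_j psi i j * (cos (theta j t - theta i t + alpha) * (omega j t - omega i t)).
Proof. by rewrite /jerk mulrC divfK ?gt_eqF// subrK. Qed.

Lemma derive1_omega i (t : R) : 0 < t -> derive1 (omega i) t = accel i t.
Proof.
move=> t0; have [_ _ _ /(_ t t0)] := sol i; rewrite -accelE => /addIr.
by apply: mulfI; rewrite gt_eqF.
Qed.

Lemma is_derive_theta i (t : R) : 0 < t -> is_derive t 1 (theta i) (omega i t).
Proof.
move=> t0; have [[d _] _ /(_ t t0) <- _] := sol i.
by rewrite derive1E; apply/derivableP/d; rewrite in_itv/= t0.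
Qed.

Lemma is_derive_omega i (t : R) : 0 < t -> is_derive t 1 (omega i) (accel i t).
Proof.
move=> t0; have [_ [d _] _ _] := sol i; rewrite -derive1_omega// derive1E.
by apply/derivableP/d; rewrite in_itv/= t0.
Qed.

Lemma is_derive_accel i (t : R) : 0 < t -> is_derive t 1 (accel i) (jerk i t).
Proof.
move=> t0.
have -> : accel i = m^-1 \*: (cst (Omega i) + (K / N%:R) \*:
    (\sum_(j < N) psi i j \*: (sin \o (theta j - theta i + cst alpha))) - omega i).
  by apply/funext => s; rewrite /accel !fctE fct_sumE /= mulrC.
have th j := is_derive_theta j t0; have om := is_derive_omega i t0.
have sn (j : 'I_N) : is_derive t 1 (psi i j \*: (sin \o (theta j - theta i + cst alpha)))
    (psi i j * (cos (theta j t - theta i t + alpha) * (omega j t - omega i t))).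
  (* The added 0 is the derivative of the constant shift [alpha]. *)
  apply: is_deriveZ; rewrite -[omega j t - omega i t]addr0.
  by apply: is_derive1_comp.
have := is_deriveZ m^-1 (is_deriveB (is_deriveD (is_derive_cst (Omega i) t 1)
  (is_deriveZ (K / N%:R) (is_derive_sum sn))) om).
by rewrite add0r /jerk [_ / m]mulrC.
Qed.

Lemma cvg_theta0 i : theta i t @[t --> 0^'+] --> theta i 0.
Proof. by have [[_]] := sol i. Qed.

Lemma cvg_omega0 i : omega i t @[t --> 0^'+] --> omega i 0.
Proof. by have [_ [_]] := sol i. Qed.

(** The explicit formula inherits right continuity from the phases and velocities; the barrier
    argument needs it to start from time 0. *)
Lemma cvg_accel0 i : accel i t @[t --> 0^'+] --> accel i 0.
Proof.
apply: cvgM; last exact: cvg_cst.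
apply: cvgB; last exact: cvg_omega0.
apply: cvgD; first exact: cvg_cst.
apply: cvgM; first exact: cvg_cst.
apply: cvg_big => [|j _]; first exact: add_continuous.
apply: cvgM; first exact: cvg_cst.
apply: (@cvg_comp _ _ _ (fun t => theta j t - theta i t + alpha) sin);
  last exact: continuous_sin.
apply: cvgD; last exact: cvg_cst.
by apply: cvgB; exact: cvg_theta0.
Qed.

End Trajectory.

(** * Decay of the energy along the trajectory *)

Theorem lemma3p5 (R : realType) (N : nat) (hN : (2 <= N)%N)
  (m K alpha : R) (hm : 0 < m) (hK : 0 < K) (halpha : 0 < alpha < pi / 2)
  (Omega : 'I_N -> R)
  (psi : 'M[R]_N) (psi_ge0 : forall i j, 0 <= psi i j)
  (psi_sym : symmetric_network psi) (psi_conn : connected_network psi)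
  (theta omega : 'I_N -> R -> R)
  (sol : is_solution m K alpha Omega psi theta omega)
  (beta gamma Dinf delta c : R)
  (beta_gt0 : 0 < beta) (gamma_gt0 : 0 < gamma) (Dinf_gt0 : 0 < Dinf)
  (delta_gt0 : 0 < delta) (c_gt0 : 0 < c)
  (h1_beta : 0 < beta < pi)
  (h1_init :
    2 * m * diam Omega + 4 * m * K * psi_u psi * sin alpha
    + (1 + 4 * m * K * psi_u psi * cos alpha) * diam (fun i => theta i 0)
    + 3 * m * diam (fun i => omega i 0) < beta)
  (h2_gamma : beta < gamma < pi)
  (h2_Dinf : 0 < Dinf < Num.min (pi / 2) beta)
  (h2_delta : alpha < delta < pi / 2 - Dinf)
  (h2_c : Num.max (2 / cos (Dinf + delta)) (2 / (1 - beta / gamma)) < c)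
  (h3_mK : m * K <
    Num.min
      (eta c ^+ 2 * psi_l psi * sin gamma
        / (16 * N%:R * psi_u psi ^+ 2 * S_ N c * gamma))
      (N%:R * S_ N c / (2 * psi_l psi)))
  (h3_K1 :
    4 * (diam Omega + 2 * K * psi_u psi * sin alpha) * N%:R * S_ N c * gamma
      / (Dinf * eta c * psi_l psi * cos alpha * sin gamma) < K)
  (h3_K2 :
    64 * (diam Omega + 2 * K * psi_u psi * sin alpha)
       * (Dinf * cos alpha + sin alpha)
       * N%:R ^+ 3 * psi_u psi ^+ 2 * S_ N c ^+ 3 * gamma ^+ 2
      / (eta c ^+ 3 * psi_l psi ^+ 3 * cos alpha * sin gamma ^+ 2) < K) :
  {ae (@lebesgue_measure R), forall t : R, 0 <= t ->
    derivable (E1 m c gamma psi theta omega) t 1 /\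
    derive1 (E1 m c gamma psi theta omega) t <=
      2 * (diam Omega + 2 * K * psi_u psi * sin alpha)
      - K * psi_l psi * cos alpha * sin gamma / (N%:R * S_ N c * gamma)
        * E1 m c gamma psi theta omega t}.
Proof.
have N0 : (0 < N)%N by apply: leq_trans hN.
have /andP[bg gpi] := h2_gamma.
have gP : 0 < gamma < pi by rewrite gamma_gt0.
have bg1 : beta / gamma < 1 by rewrite ltr_pdivrMr// mul1r.
have bg0 : 0 < beta / gamma by rewrite divr_gt0.
have c_gt : 2 / (1 - beta / gamma) < c by move: h2_c; rewrite gt_max => /andP[].
have c_gt2 : 2 < c.
  by apply: lt_trans c_gt; rewrite ltr_pdivlMr ?subr_gt0//; lra.
have eta_gt : beta / gamma < eta c.
  by move: c_gt; rewrite ltr_pdivrMr ?subr_gt0// -ltr_pdivrMl// mulrC /eta; lra.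
have eta0 : 0 < eta c by exact: lt_trans eta_gt.
move: h3_mK; rewrite lt_min => /andP[mK1 mK2].
set B := diam Omega + _ in h3_K1 *.
have EB : B = forcing psi K alpha Omega by [].
set kap := _ / (N%:R * S_ N c * gamma).
have mu_bounds := velocity_coef_bounds hN psi_conn c_gt2 gP.
set mu := velocity_coef psi c gamma in mu_bounds.
have /andP[mu0 mu1] := mu_bounds.
(* The condition [h3_K1] reads 4 B < kap Dinf eta, while Dinf < beta and eta <= 1. *)
have kap_lt : 2 * B < kap * beta.
  have sg0 := sin_gt0_pi gP; have l0 := psi_l_gt0 hN psi_conn.
  have S0 := S_gt0 N0 c_gt2; have NR0 : 0 < N%:R :> R by rewrite ltr0n.
  have ca0 : 0 < cos alpha.
    by have /andP[? ?] := halpha; apply: cos_gt0_pihalf; apply/andP; split; lra.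
  have kap0 : 0 < kap by rewrite /kap divr_gt0// !mulr_gt0.
  have B4 : 4 * B < kap * (Dinf * eta c).
    move: h3_K1; rewrite ltr_pdivrMr ?mulr_gt0// => h.
    have -> : kap * (Dinf * eta c) =
        K * (Dinf * eta c * psi_l psi * cos alpha * sin gamma) / (N%:R * S_ N c * gamma).
      by rewrite /kap; ring.
    rewrite ltr_pdivlMr; last by rewrite !mulr_gt0.
    by rewrite !mulrA in h *.
  have eta1 : eta c <= 1 by rewrite /eta gerBl divr_ge0// ltW.
  have : kap * (Dinf * eta c) <= kap * beta.
    rewrite ler_pM2l// -[leRHS]mulr1; apply: ler_pM => //; [exact: ltW|exact: ltW|].
    by have /andP[_] := h2_Dinf; rewrite lt_min => /andP[_ /ltW].
  have := mulr_gt0 kap0 beta_gt0; lra.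
have motion := accelE psi K alpha Omega theta omega hm.
pose acc := accel psi m K alpha Omega theta omega.
pose jer := jerk psi m K alpha Omega theta omega.
pose energy (th om a : 'I_N -> R) (s : {perm 'I_N} * {perm 'I_N} * {perm 'I_N}) :=
  Y_perm c s.1.1 th + mu * (m * Y_perm c s.1.2 om) + 2 * m ^+ 2 * Y_perm c s.2 a.
pose at_ (x : 'I_N -> R -> R) t i := x i t.
pose f s t := energy (at_ theta t) (at_ omega t) (at_ acc t) s.
pose f' s t := energy (at_ omega t) (at_ acc t) (at_ jer t) s.
(* This is the energy with [acc] in place of the derivative of [omega], so that its value at time 0
   is controlled; it agrees with [E1] for t > 0. *)
pose M t := Y c (at_ theta t) + mu * (m * Y c (at_ omega t)) + 2 * m ^+ 2 * Y c (at_ acc t).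
have Y0 (z : 'I_N -> R) : 0 <= Y c z.
  by have := eta_diff_le_Y N0 c_gt2 z (Ordinal N0) (Ordinal N0); rewrite subrr mulr0.
have mum : 0 < mu * m by exact: mulr_gt0.
have m2 : 0 < 2 * m ^+ 2 by rewrite mulr_gt0// exprn_gt0.
have fM t s : f s t <= M t.
  rewrite /f /M /energy; apply: lerD; first apply: lerD; first exact: Y_perm_le_Y.
    by rewrite !mulrA ler_pM2l//; exact: Y_perm_le_Y.
  by rewrite ler_pM2l//; exact: Y_perm_le_Y.
have Mf t : exists s, M t = f s t.
  have [_ [p pE]] := Y_permP N0 c_gt2 (at_ theta t).
  have [_ [q qE]] := Y_permP N0 c_gt2 (at_ omega t).
  have [_ [r rE]] := Y_permP N0 c_gt2 (at_ acc t).
  by exists (p, q, r); rewrite /f /energy /= pE qE rE.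
have fE s (t : R) : 0 < t -> is_derive t 1 (f s) (f' s t).
  move=> t0.
  have dt := is_derive_Y_perm c s.1.1 (fun i => is_derive_theta sol i t0).
  have dw := is_derive_Y_perm c s.1.2 (fun i => is_derive_omega hm sol i t0).
  have da := is_derive_Y_perm c s.2 (fun i => is_derive_accel hm sol i t0).
  exact: is_deriveD (is_deriveD dt (is_deriveZ mu (is_deriveZ m dw)))
    (is_deriveZ (2 * m ^+ 2) da).
have f0 s : f s t @[t --> 0^'+] --> f s 0.
  apply: cvgD; first apply: cvgD.
  - by apply: cvg_Y_perm => i; exact: cvg_theta0 sol i.
  - apply: cvgM; first exact: cvg_cst.
    apply: cvgM; first exact: cvg_cst.
    by apply: cvg_Y_perm => i; exact: cvg_omega0 sol i.
  - apply: cvgM; first exact: cvg_cst.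
    by apply: cvg_Y_perm => i; exact: cvg_accel0 sol i.
(* Each form is at most its [Y] and the coefficients are positive, so equality of the sums forces
   equality term by term. The phase bound follows from eta (theta_i - theta_j) <= M <= beta < eta
   gamma. *)
have dissipation t s : M t <= beta -> f s t = M t -> f' s t <= 2 * B - kap * M t.
  case: s => [[p q] r] Mb.
  rewrite /f /energy /M /= => fMt.
  have hp := Y_perm_le_Y N0 c_gt2 p (at_ theta t).
  have hq := Y_perm_le_Y N0 c_gt2 q (at_ omega t).
  have hr := Y_perm_le_Y N0 c_gt2 r (at_ acc t).
  have hq' : mu * (m * Y_perm c q (at_ omega t)) <= mu * (m * Y c (at_ omega t)).
    by rewrite !mulrA ler_pM2l.
  have hr' : 2 * m ^+ 2 * Y_perm c r (at_ acc t) <= 2 * m ^+ 2 * Y c (at_ acc t).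
    by rewrite ler_pM2l.
  have pE : Y_perm c p (at_ theta t) = Y c (at_ theta t) by lra.
  have qE : Y_perm c q (at_ omega t) = Y c (at_ omega t).
    by apply: (mulfI (lt0r_neq0 hm)); apply: (mulfI (lt0r_neq0 mu0)); lra.
  have rE : Y_perm c r (at_ acc t) = Y c (at_ acc t).
    by apply: (mulfI (lt0r_neq0 m2)); lra.
  apply: (energy_dissipation hN psi_ge0 psi_sym psi_conn c_gt2 hm hK halpha
    (fun i => motion i t) gP) => // [i j|i|].
  - have YM : Y c (at_ theta t) <= M t.
      have := mulr_ge0 (ltW mum) (Y0 (at_ omega t)).
      by have := mulr_ge0 (ltW m2) (Y0 (at_ acc t)); rewrite /M; lra.
    rewrite -(ler_pM2l eta0) (le_trans (eta_diff_le_Y N0 c_gt2 (at_ theta t) i j))//.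
    rewrite (le_trans YM)// (le_trans Mb)// -ler_pdivrMr// ltW//.
  - exact: jerkE.
  - exact: (Y_perm_sorted N0 c_gt2 pE).
have lt_beta (t : R) : 0 <= t -> M t < beta.
  move=> t0; have [s ->] := Mf t.
  apply: (finite_max_barrier fE f0 _ _ t0 s) => {t t0 s} [s|t t0 fb s fs].
    (* At time 0 the three terms are at most D_theta, m D_omega (as mu <= 1) and, by
       [velocity_estimate], 2 m (D_omega + B + 2 K psi_u cos alpha D_theta). Their total is the left
       side of [h1_init]. *)
    case: s => [[p q] r]; rewrite /f /energy /=.
    set th := at_ theta 0; set om := at_ omega 0.
    have hp : Y_perm c p th <= diam th by apply: Y_perm_le => // i j; exact: le_diam.
    have hom l : Y_perm c l om <= diam om by apply: Y_perm_le => // i j; exact: le_diam.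
    have hq : mu * (m * Y_perm c q om) <= m * diam om.
      have D0 : 0 <= m * diam om.
        by rewrite mulr_ge0 ?(ltW hm)// -(subrr (om (Ordinal N0))) le_diam.
      by rewrite (@le_trans _ _ (mu * (m * diam om)))// ?ler_piMl// ler_pM2l// ler_pM2l.
    have hr := velocity_estimate hN psi_ge0 psi_conn c_gt2 hK halpha (fun i => motion i 0) r
      (le_diam th).
    have hrN : - Y_perm c r om <= diam om.
      have [_ [l lE]] := Y_permP N0 c_gt2 om.
      by rewrite lerNl (le_trans _ (Y_perm_geNY N0 c_gt2 r om))// lerN2 -lE.
    have := ler_wpM2l (mulr_ge0 (ler0n R 2) (ltW hm)) hr.
    have := ler_wpM2l (mulr_ge0 (ler0n R 2) (ltW hm)) hrN.
    move: h1_init; rewrite -/th -/om -EB /B; lra.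
  have Mb : M t = beta.
    by apply/eqP; rewrite eq_le -{2}fs fM andbT; have [u ->] := Mf t; exact: fb.
  have := dissipation t s; rewrite Mb => /(_ (lexx _) fs).
  by move: kap_lt; lra.
have [C cC CP] := finite_max_is_derive fE (fun t _ => conj (fM t) (Mf t)).
have ME (t : R) : 0 < t -> E1 m c gamma psi theta omega t = M t.
  move=> t0; rewrite /E1 /Q /F /A /M; congr (_ + _ + _ * Y c _).
  by apply/funext => i; exact: derive1_omega.
have countable_negligible (D : set R) :
    countable D -> (@lebesgue_measure R).-negligible D.
  move=> cD; exists D; split=> //; first exact: countable_measurable.
  exact: countable_lebesgue_measure0.
(* Time 0 joins the exceptional set because [E1] and [M] are compared only for t > 0. *)
have [D [mD D0 CD]] := negligibleU (countable_negligible _ cC)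
  (countable_negligible _ (countable1 0)).
exists D; split=> //; apply: subset_trans CD.
move=> t /= nP; apply: contrapT => /not_orP[nC t0N]; apply: nP => t0.
have {t0N} t0 : 0 < t by rewrite lt_neqAle t0 andbT; apply/eqP => /esym.
have [s fs dM] := CP t t0 nC.
have dE : is_derive t 1 (E1 m c gamma psi theta omega) (f' s t).
  apply: near_eq_is_derive dM; near=> u; rewrite ME//; near: u.
  exact: lt_nbhsr.
split; first exact: ex_derive.
rewrite derive1E derive_val ME//; apply: dissipation => //.
by rewrite ltW// lt_beta// ltW.
Unshelve. all: by end_near. Qed.
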